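(* Every univalent updown category $\mathcal C$ has a universal cover $\tilde{\mathcal C}$; that is, there exist a univalent updown category $\tilde{\mathcal C}$ and a universal covering map $\pi:\tilde{\mathcal C}\to\mathcal C$.
   Context: An updown category is a small category $\mathcal C$ with a rank functor $|\cdot|:\mathcal C\to\mathbb N$ (where $\mathbb N=\{0,1,2,\dots\}$ is the ordered set of natural numbers regarded as a category) such that: (A1) each rank $\mathcal C_n=\{p\in\operatorname{Ob}\mathcal C:|p|=n\}$ is finite; (A2) $\mathcal C_0$ consists of a single object $\hat 0$, and $\operatorname{Hom}(\hat 0,p)$ is nonempty for all objects $p$; (A3) for objects $p,p'$, $\operatorname{Hom}(p,p')$ is always finite, and $\operatorname{Hom}(p,p')=\emptyset$ unless $|p|<|p'|$ or $p=p'$; in the latter case $\operatorname{Hom}(p,p)$ is a group, denoted $\operatorname{Aut}(p)$; (A4) any morphism $p\to p'$ with $|p'|=|p|+k$ factors as a composition $p=p_0\to p_1\to\cdots\to p_k=p'$ with $|p_{i+1}|=|p_i|+1$; (A5) if $|p'|=|p|+1$, the actions of $\operatorname{Aut}(p)$ and $\operatorname{Aut}(p')$ on $\operatorname{Hom}(p,p')$ (by precomposition and postcomposition respectively) are free. $\mathcal C$ is univalent if $\operatorname{Aut}(p)$ is trivial for all $p\in\operatorname{Ob}\mathcal C$. A morphism $F:\mathcal C\to\mathcal D$ of univalent updown categories is a rank-preserving functor such that for all $p,q\in\operatorname{Ob}\mathcal C$ with $|q|=|p|+1$ the induced function $\coprod_{\{q':F(q')=F(q)\}}\operatorname{Hom}(p,q')\to\operatorname{Hom}(F(p),F(q))$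 is injective. A morphism $\pi:\mathcal C'\to\mathcal C$ of univalent updown categories is a covering map if $\pi$ is surjective on the object sets and the induced function $\coprod_{\{q':\pi(q')=\pi(q)\}}\operatorname{Hom}(p,q')\to\operatorname{Hom}(\pi(p),\pi(q))$ is a bijection for all $p,q\in\operatorname{Ob}\mathcal C'$ with $|q|=|p|+1$. A covering map $\pi:\tilde{\mathcal C}\to\mathcal C$ is universal if for any other covering map $\phi:\mathcal C'\to\mathcal C$ there is a covering map $\psi:\tilde{\mathcal C}\to\mathcal C'$ with $\pi=\phi\psi$; then $\tilde{\mathcal C}$ is called a universal cover of $\mathcal C$. *)

(* Defs.v *)
From mathcomp Require Import all_boot.
From mathcomp Require Import classical_sets functions cardinality.

Set Implicit Arguments.
Unset Strict Implicit.
Unset Printing Implicit Defensive.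

Local Open Scope classical_set_scope.

Record category := Category {
  obj :> Type;
  hom : obj -> obj -> Type;
  idm : forall p, hom p p;
  comp : forall p q r, hom q r -> hom p q -> hom p r;
  comp_idl : forall p q (f : hom p q), comp (idm q) f = f;
  comp_idr : forall p q (f : hom p q), comp f (idm p) = f;
  comp_assoc : forall p q r s (h : hom r s) (g : hom q r) (f : hom p q),
    comp h (comp g f) = comp (comp h g) f
}.

Arguments hom {c} _ _.
Arguments idm {c} _.
Arguments comp {c p q r} _ _.

Record functor (C D : category) := Functor {
  fobj :> C -> D;
  fhom : forall p q : C, hom p q -> hom (fobj p) (fobj q);
  fhom_id : forall p : C, fhom (idm p) = idm (fobj p);
  fhom_comp : forall (p q r : C) (g : hom q r) (f : hom p q),
    fhom (comp g f) = comp (fhom g) (fhom f)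
}.

Section FunctorComp.
Variables (C D E : category) (G : functor D E) (F : functor C D).

Let comp_fhom (p q : C) (f : hom p q) : hom (G (F p)) (G (F q)) :=
  fhom G (fhom F f).

Lemma functor_comp_id (p : C) : comp_fhom (idm p) = idm (G (F p)).
Proof. by rewrite /comp_fhom !fhom_id. Qed.

Lemma functor_comp_comp (p q r : C) (g : hom q r) (f : hom p q) :
  comp_fhom (comp g f) = comp (comp_fhom g) (comp_fhom f).
Proof. by rewrite /comp_fhom !fhom_comp. Qed.

Definition functor_comp : functor C E :=
  Functor functor_comp_id functor_comp_comp.

End FunctorComp.

Definition nat_cat : category :=
  @Category nat (fun m n => is_true (m <= n)) leqnn
    (fun m n k (nk : n <= k) (mn : m <= n) => leq_trans mn nk)
    (fun m n f => bool_irrelevance _ f)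
    (fun m n f => bool_irrelevance _ f)
    (fun m n k l h g f => bool_irrelevance _ _).

(* [climb rk k f]: f is a composite p = p_0 -> p_1 -> ... -> p_k = q of
   k >= 1 morphisms, each raising rk by exactly one. *)
Inductive climb (C : category) (rk : C -> nat) :
    nat -> forall p q : C, hom p q -> Prop :=
| climb_one p q (f : hom p q) :
    rk q = (rk p).+1 -> climb rk 1 f
| climb_succ k p q r (f : hom p q) (g : hom q r) :
    rk q = (rk p).+1 -> climb rk k g -> climb rk k.+1 (comp g f).

Record updown_axioms (C : category) (rk : C -> nat) : Prop := UpdownAxioms {
  finite_rank : forall n, finite_set [set p | rk p = n];
  rank_zero : exists z : C,
    [set p | rk p = 0] = [set z] /\ forall p, inhabited (hom z p);
  finite_hom : forall p q : C, finite_set [set: hom p q];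
  hom_rank : forall p q : C, hom p q -> rk p < rk q \/ p = q;
  end_group : forall (p : C) (a : hom p p),
    exists b : hom p p, comp a b = idm p /\ comp b a = idm p;
  (* k = 0 is excluded: there f is an automorphism and has nothing to factor
     through, while an empty composite would force f to be an identity. *)
  hom_factor : forall (k : nat) (p q : C) (f : hom p q),
    0 < k -> rk q = rk p + k -> climb rk k f;
  free_aut_source : forall (p q : C) (f : hom p q) (a : hom p p),
    rk q = (rk p).+1 -> comp f a = f -> a = idm p;
  free_aut_target : forall (p q : C) (f : hom p q) (b : hom q q),
    rk q = (rk p).+1 -> comp b f = f -> b = idm q
}.

Record updown := Updown {
  updown_cat :> category;
  rank_functor : functor updown_cat nat_cat;
  updownP : updown_axioms rank_functor
}.

Definition rank (C : updown) (p : C) : nat := rank_functor C p.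

(* Aut(p) is all of Hom(p, p), by [end_group]. *)
Definition univalent (C : updown) : Prop :=
  forall (p : C) (a : hom p p), a = idm p.

Record univalent_updown := UnivalentUpdown {
  univalent_cat :> updown;
  univalentP : univalent univalent_cat
}.

(* The coproduct of the Hom(p, q') over all q' with F q' = F q. *)
Definition hom_fiber (C D : category) (F : functor C D) (p q : C) : Type :=
  {q' : {q' : C | F q' = F q} & hom p (sval q')}.

(* The map f |-> F f induced on it; F f lies in Hom(F p, F q') and is
   transported along F q' = F q. *)
Definition fiber_map (C D : category) (F : functor C D) (p q : C)
    (x : hom_fiber F p q) : hom (F p) (F q) :=
  ecast d (hom (F p) d) (svalP (projT1 x)) (fhom F (projT2 x)).

Arguments fiber_map {C D} F p q x.

Definition updown_morphism (C D : univalent_updown) (F : functor C D) : Prop :=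
  (forall p : C, rank (F p) = rank p) /\
  (forall p q : C, rank q = (rank p).+1 -> injective (fiber_map F p q)).

Definition covering_map (C D : univalent_updown) (F : functor C D) : Prop :=
  [/\ updown_morphism F,
      forall d : D, exists c : C, F c = d
    & forall p q : C, rank q = (rank p).+1 -> bijective (fiber_map F p q)].

Definition universal_covering_map (Ct C : univalent_updown)
    (pi : functor Ct C) : Prop :=
  covering_map pi /\
  forall (C' : univalent_updown) (phi : functor C' C), covering_map phi ->
    exists psi : functor Ct C', covering_map psi /\ pi = functor_comp phi psi.

(* Main.v *)
From mathcomp Require Import all_boot.
From mathcomp Require Import boolp classical_sets cardinality.
Require Import Defs.

(* The universal cover is the tree of chains of rank-one morphisms starting at
   the bottom object, ordered by extension, and projected to the end of a chain.
   Under rank preservation, a covering map is the same as a functor with unique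
   lifting of single rank-one morphisms, since surjectivity on objects follows
   by lifting a factorization of a morphism out of the bottom object. Lifting
   chains step by step through a covering phi gives the factorization
   pi = phi psi, and psi is then a covering because both pi and phi lift steps uniquely. *)

Set Implicit Arguments.
Unset Strict Implicit.
Unset Printing Implicit Defensive.

Local Open Scope classical_set_scope.

(** * Dependent pairs, transport and bijections *)

Lemma existT_inj2 (T : Type) (P : T -> Type) (a : T) (x y : P a) :
  existT P a x = existT P a y -> x = y.
Proof.
move=> e; have := projT2_eq e.
by rewrite (Prop_irrelevance (projT1_eq e) erefl).
Qed.

Lemma ecast_existT (T : Type) (P : T -> Type) (a b : T) (e : a = b)
    (x : P a) (y : P b) :
  ecast d (P d) e x = y <-> existT P a x = existT P b y.
Proof.
case: b / e y => y; split=> [-> //|e].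
exact: existT_inj2 e.
Qed.

Lemma inj_surj_bijective (A B : Type) (f : A -> B) :
  injective f -> (forall y, exists x, f x = y) -> bijective f.
Proof.
move=> finj fsurj; pose g y := projT1 (cid (fsurj y)).
have fg : cancel g f by move=> y; rewrite /g; case: cid.
by exists g => // x; apply: finj; rewrite fg.
Qed.

(** * Covering maps as unique lifting of rank-one morphisms *)

Definition star (C : category) (p : C) : Type := {q : C & hom p q}.

Definition star_map (C D : category) (F : functor C D) (p : C) (s : star p) :
    star (F p) :=
  existT _ (F (projT1 s)) (fhom F (projT2 s)).

Section FiberStar.
Variables (C D : category) (F : functor C D) (p q : C).

(** Dropping the proof that the target lies over [F q] loses nothing, and turns questions on
    [fiber_map] into questions on [star_map], where no transport occurs. *)
Definition fiber_star (x : hom_fiber F p q) : star p :=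
  existT _ (sval (projT1 x)) (projT2 x).

Lemma fiber_star_inj : injective fiber_star.
Proof.
case=> -[q1 e1] f1 [[q2 e2] f2]; rewrite /fiber_star /= => e.
have eq12 := projT1_eq e; rewrite /= in eq12.
case: q2 / eq12 e2 f2 e => e2 f2 e.
by rewrite (existT_inj2 e) (Prop_irrelevance e1 e2).
Qed.

Lemma fiber_mapE (x : hom_fiber F p q) (f : hom (F p) (F q)) :
  fiber_map F p q x = f <-> star_map F (fiber_star x) = existT _ (F q) f.
Proof. exact: ecast_existT. Qed.

Lemma fiber_starP (s : star p) (f : hom (F p) (F q)) :
  star_map F s = existT _ (F q) f -> exists x, fiber_star x = s.
Proof.
case: s => q' h e.
by exists (existT (fun q' : {q' | F q' = F q} => hom p (sval q'))
  (exist _ q' (projT1_eq e)) h).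
Qed.

End FiberStar.

(** Uniqueness is among all morphisms out of [p]; when [F] preserves rank, every lift rises by one
    rank automatically. *)
Definition unique_step_lifting (C D : updown) (F : functor C D) : Prop :=
  forall (p : C) (t : star (F p)), rank (projT1 t) = (rank (F p)).+1 ->
    exists! s, star_map F s = t.

Lemma rank_zero_unique (C : updown) (p q : C) :
  rank p = 0 -> rank q = 0 -> p = q.
Proof.
have [z [zP _]] := rank_zero (updownP C).
have eqz r : rank r = 0 -> r = z by move/predeqP: zP => /(_ r)[].
by move=> /eqz-> /eqz->.
Qed.

Lemma exists_root (C : updown) :
  exists z : C, rank z = 0 /\ forall p, inhabited (hom z p).
Proof.
have [z [zP zhom]] := rank_zero (updownP C).
by exists z; split=> //; move/predeqP: zP => /(_ z)[_]; apply.
Qed.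

Lemma step_lifting_surj (C D : updown) (F : functor C D) :
  (forall p, rank (F p) = rank p) -> unique_step_lifting F ->
  forall d, exists c, F c = d.
Proof.
move=> rkF liftF d.
have [zC [zC0 _]] := exists_root C.
have [zD [zD0 /(_ d)[f]]] := exists_root D.
have FzC : F zC = zD by apply: rank_zero_unique; rewrite ?rkF.
have lift_arrow p q (g : hom p q) : rank q = (rank p).+1 ->
    (exists c, F c = p) -> exists c, F c = q.
  move=> rkq [c Fc]; case: p / Fc g rkq => g rkq.
  have [s [sg _]] := liftF c (existT _ q g) rkq.
  by exists (projT1 s); exact: (projT1_eq sg).
(* Rank zero is treated apart because [hom_factor] requires a positive rank difference. *)
have [d0|d_gt0] := posnP (rank d).
  by exists zC; rewrite FzC; apply: rank_zero_unique.
have cl : climb (rank_functor D) (rank d) f.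
  apply: (hom_factor (updownP D)) => //.
  by rewrite -[RHS]/(rank zD + rank d) zD0.
have : exists c, F c = zD by exists zC.
elim: cl => [p q g rkq|k p q r g h rkq _ IH pF].
  exact: lift_arrow g rkq.
exact/IH/(lift_arrow p q g).
Qed.

Lemma covering_mapP (C D : univalent_updown) (F : functor C D) :
  covering_map F <->
  (forall p, rank (F p) = rank p) /\ unique_step_lifting F.
Proof.
split=> [[[rkF _] surjF bijF]|[rkF liftF]].
  (* [fiber_map] only reaches targets of the form [F q]; surjectivity puts [d] in that form. *)
  split=> // p [d f] /= rkd; case: (surjF d) => q Fq.
  case: d / Fq f rkd => f rkd; rewrite !rkF in rkd.
  have [g fK gK] := bijF p q rkd.
  exists (fiber_star (g f)); split=> [|s sf]; first by apply/fiber_mapE.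
  have [x xs] := fiber_starP sf.
  rewrite -{}xs in sf *; congr fiber_star.
  by apply: (can_inj fK); rewrite gK; apply/esym/fiber_mapE.
have bijF p q : rank q = (rank p).+1 -> bijective (fiber_map F p q).
  move=> rkq; rewrite -!rkF in rkq; apply: inj_surj_bijective.
    move=> x y xy; apply: fiber_star_inj.
    have [s [_ sP]] := liftF p (existT _ (F q) (fiber_map F p q x)) rkq.
    by transitivity s; [apply/esym|]; apply: sP; apply/fiber_mapE.
  move=> f; have [s [sf _]] := liftF p (existT _ (F q) f) rkq.
  have [x xs] := fiber_starP sf.
  by exists x; apply/fiber_mapE; rewrite xs.
split=> //; last exact: step_lifting_surj.
by split=> // p q /bijF/bij_inj.
Qed.

(** To lift [t] through [F], lift its image under [G] through the composite: the [F]-image of that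
    lift and [t] are both [G]-lifts of the same step, hence equal. Conversely, an [F]-lift of [t] is
    a lift of its image through the composite, hence unique. *)
Lemma covering_map_cancel (C D E : univalent_updown) (G : functor D E)
    (F : functor C D) :
  covering_map G -> covering_map (functor_comp G F) -> covering_map F.
Proof.
move=> /covering_mapP[rkG liftG] /covering_mapP[rkGF liftGF].
apply/covering_mapP; split=> [p|p t rkt]; first by rewrite -rkG -rkGF.
have rkGt : rank (projT1 (star_map G t)) = (rank (G (F p))).+1.
  by rewrite /= !rkG.
have [s [sGt sP]] := liftGF p (star_map G t) rkGt.
have [t' [_ t'P]] := liftG (F p) (star_map G t) rkGt.
exists s; split=> [|s' s't]; last by apply: sP; rewrite -s't.
by rewrite -(t'P t) // (t'P (star_map F s)).
Qed.

(** * Equality of functors *)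

(* Morphisms bundled with their endpoints: equality in this type compares
   morphisms whose endpoints are only propositionally equal. *)
Definition arrow (C : category) : Type := {p : C & star p}.

Definition mk_arrow (C : category) (p q : C) (f : hom p q) : arrow C :=
  existT _ p (existT _ q f).

Lemma mk_arrow_tgt (C : category) (p q p' q' : C) (f : hom p q)
    (f' : hom p' q') :
  mk_arrow f = mk_arrow f' -> q = q'.
Proof. by move/(congr1 (fun u : arrow C => projT1 (projT2 u))). Qed.

Lemma mk_arrow_comp (C : category) (p q r p' q' r' : C) (g : hom q r)
    (f : hom p q) (g' : hom q' r') (f' : hom p' q') :
  mk_arrow g = mk_arrow g' -> mk_arrow f = mk_arrow f' ->
  mk_arrow (comp g f) = mk_arrow (comp g' f').
Proof.
move=> eg ef; have ep := projT1_eq ef; have eq := projT1_eq eg.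
rewrite /= in ep eq; case: p' / ep f' ef => f' ef.
case: q' / eq f' g' eg ef => f' g' eg ef.
rewrite (existT_inj2 (existT_inj2 ef)).
have er := projT1_eq (existT_inj2 eg); rewrite /= in er.
by case: r' / er g' eg => g' eg; rewrite (existT_inj2 (existT_inj2 eg)).
Qed.

Lemma functor_eq (C D : category) (F G : functor C D) :
  (forall p q (f : hom p q), mk_arrow (fhom F f) = mk_arrow (fhom G f)) ->
  F = G.
Proof.
case: F G => [F0 F1 Fid Fcomp] [G0 G1 Gid Gcomp] /= FG.
have eFG : F0 = G0 by apply/funext=> p; exact: (projT1_eq (FG p p (idm p))).
case: G0 / eFG G1 Gid Gcomp FG => G1 Gid Gcomp FG.
have eFG : F1 = G1.
  apply/functional_extensionality_dep=> p.
  apply/functional_extensionality_dep=> q.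
  apply/functional_extensionality_dep=> f.
  exact: existT_inj2 (existT_inj2 (FG p q f)).
case: G1 / eFG Gid Gcomp FG => Gid Gcomp FG.
by rewrite (Prop_irrelevance Fid Gid) (Prop_irrelevance Fcomp Gcomp).
Qed.

(** * The tree of chains as a free category *)

Section Tree.
Variables (C : updown) (z : C).
Hypothesis z0 : rank z = 0.

Inductive chain : C -> Type :=
| chain_nil : chain z
| chain_rcons p (c : chain p) (s : star p) :
    rank (projT1 s) = (rank p).+1 -> chain (projT1 s).

Definition node : Type := {p : C & chain p}.

Definition tip (x : node) : C := projT1 x.

Definition root : node := existT _ z chain_nil.

Definition child (x : node) (s : star (tip x))
    (e : rank (projT1 s) = (rank (tip x)).+1) : node :=
  existT _ (projT1 s) (chain_rcons (projT2 x) e).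

Lemma rank_child x s e :
  rank (tip (@child x s e)) = (rank (tip x)).+1.
Proof. exact: e. Qed.

Lemma node_ind (P : node -> Prop) :
  P root -> (forall x s e, P x -> P (@child x s e)) -> forall x, P x.
Proof.
move=> Proot Pchild [p c].
by elim: c => [//|{}p c IH s e]; apply: (Pchild (existT _ p c)).
Qed.

(* A left inverse of child, giving injectivity of child without inverting
   dependent equalities between chains. *)
Definition parent_step (x : node) : option {x : node & star (tip x)} :=
  if projT2 x is chain_rcons p c s _
  then Some (existT (fun x => star (tip x)) (existT _ p c) s) else None.

Lemma parent_step_child x s e :
  parent_step (@child x s e) = Some (existT _ x s).
Proof. by case: x s e. Qed.

Lemma child_inj x s e x' s' e' :
  @child x s e = @child x' s' e' ->
  existT (fun x => star (tip x)) x s = existT _ x' s'.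
Proof. by move/(congr1 parent_step); rewrite !parent_step_child => -[]. Qed.

(** Valued in [Type] so that functors can be defined by recursion on an extension; that there is at
    most one is [ext_irr]. *)
Inductive ext (x : node) : node -> Type :=
| ext_refl : ext x x
| ext_child y (s : star (tip y)) (e : rank (projT1 s) = (rank (tip y)).+1) :
    ext x y -> ext x (child e).

Fixpoint ext_trans x y w (g : ext y w) : ext x y -> ext x w :=
  match g in ext _ w return ext x y -> ext x w with
  | ext_refl => fun f => f
  | ext_child _ _ e g => fun f => ext_child e (ext_trans g f)
  end.

Lemma ext_trans_refl x y (f : ext x y) : ext_trans f (ext_refl x) = f.
Proof. by elim: f => //= {}y s e f ->. Qed.

Lemma ext_transA x y w v (h : ext w v) (g : ext y w) (f : ext x y) :
  ext_trans h (ext_trans g f) = ext_trans (ext_trans h g) f.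
Proof. by elim: h => //= {}v s e h ->. Qed.

Definition tree_cat : category :=
  @Category node ext ext_refl (fun x y w g f => ext_trans g f)
    (fun x y f => erefl) ext_trans_refl ext_transA.

Definition child_arrow (x : tree_cat) s e : hom x (@child x s e : tree_cat) :=
  ext_child e (ext_refl x).

Section FreeFunctor.
Variables (D : category) (h : node -> D).
Variable a : forall x s e, hom (h x) (h (@child x s e)).

(** The tree category is free on its edges: the images of nodes and edges may be prescribed with no
    relation to check. *)
Fixpoint free_hom x y (g : ext x y) : hom (h x) (h y) :=
  match g in ext _ y return hom (h x) (h y) with
  | ext_refl => idm (h x)
  | ext_child _ _ e g => comp (a e) (free_hom g)
  end.

Lemma free_hom_comp x y w (g : ext y w) (f : ext x y) :
  free_hom (ext_trans g f) = comp (free_hom g) (free_hom f).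
Proof.
by elim: g => [|{}w s e g IH] /=; rewrite ?comp_idl // IH comp_assoc.
Qed.

Definition free_functor : functor tree_cat D :=
  @Functor tree_cat D h free_hom (fun=> erefl) free_hom_comp.

End FreeFunctor.

Lemma tree_functor_eq (D : category) (F G : functor tree_cat D) :
  F root = G root ->
  (forall x s e, mk_arrow (fhom F (@child_arrow x s e)) =
                 mk_arrow (fhom G (@child_arrow x s e))) ->
  F = G.
Proof.
move=> FGroot FGstep; apply: functor_eq => x y.
have FGobj w : F w = G w.
  elim/node_ind: w => // w s e _.
  exact: mk_arrow_tgt (FGstep w s e).
elim=> [|{}y s e f IH].
  rewrite -/(idm (x : tree_cat)) !fhom_id.
  by case: (G x) / (FGobj x).
rewrite -[ext_child e f]/(comp (child_arrow e) (f : hom (x : tree_cat) y)).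
by rewrite !fhom_comp; apply: mk_arrow_comp.
Qed.

Definition tree_proj : functor tree_cat C :=
  @free_functor C tip (fun x s _ => projT2 s).

(** * The tree is a univalent updown category *)

Lemma ext_rank x y (g : ext x y) : rank (tip x) < rank (tip y) \/ x = y.
Proof.
elim: g => [|{}y s e g IH]; first by right.
by left; rewrite rank_child ltnS; case: IH => [/ltnW|->].
Qed.

Lemma ext_rank_eq x y (g : ext x y) : rank (tip x) = rank (tip y) -> x = y.
Proof. by case: (ext_rank g) => // + e; rewrite e ltnn. Qed.

Lemma ext_child_rank x s e : ext (@child x s e) x -> False.
Proof.
case/ext_rank=> [|/(congr1 (fun y => rank (tip y)))]; rewrite rank_child.
  by move/ltnW; rewrite ltnn.
by move/eqP; rewrite eqn_leq ltnn.
Qed.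

(** A child determines its parent and the step from it, and rank rises along steps, so the endpoints
    force the last step. *)
Lemma ext_irr x y (f g : ext x y) : f = g.
Proof.
(* The endpoint of the second extension is freed and tied back by [E], so that both extensions can
   be split by cases. *)
suff eqE w (h : ext x w) (E : y = w) : ecast w (ext x w) E f = h.
  exact: (eqE y g erefl).
elim: {g} f w h E => [|{}y s e f IH] w [|{}w s' e' h] E.
- by rewrite (Prop_irrelevance E erefl).
(* If just one extension is trivial, the other would lead from a child back to its parent. *)
- by case: (ext_child_rank (ecast v (ext v w) E h)).
- by case: (ext_child_rank (ecast v (ext v y) (esym E) f)).
have E' := child_inj E; have yw := projT1_eq E'; rewrite /= in yw.
case: w / yw s' e' h E E' => s' e' h E E'.
have ss := existT_inj2 E'; case: s' / ss e' E E' => e' E _.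
rewrite (Prop_irrelevance e' e) in E *.
by rewrite (Prop_irrelevance E erefl) /= -(IH y h erefl).
Qed.

Definition tree_rank : functor tree_cat nat_cat :=
  functor_comp (rank_functor C) tree_proj.

(** [climb] adds steps at the source, whereas [ext] adds them at the target. *)
Lemma climb_rcons (D : category) (rk : D -> nat) k (p q r : D) (f : hom p q)
    (g : hom q r) :
  climb rk k f -> rk r = (rk q).+1 -> climb rk k.+1 (comp g f).
Proof.
move=> cl; elim: cl g => {k p q f} [p q f pq|k p q q' f f' pq _ IH] g qr.
  by apply: climb_succ => //; apply: climb_one.
by rewrite comp_assoc; apply: climb_succ => //; apply: IH.
Qed.

Lemma tree_climb (k : nat) (x y : tree_cat) (f : hom x y) :
  0 < k -> tree_rank y = tree_rank x + k -> climb tree_rank k f.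
Proof.
elim: f k => [|{}y s e f IH] k k_gt0 rky.
  move/eqP: rky; rewrite -[X in X == _]addn0 eqn_add2l eq_sym.
  by rewrite -leqn0 leqNgt k_gt0.
case: k k_gt0 rky => // k _ rky.
have {}rky : tree_rank y = tree_rank x + k.
  by apply: succn_inj; rewrite -addnS -rky; apply: esym; exact: e.
(* For [k = 0] the whole extension is a single step, as [climb] has no empty composite to append
   to. *)
case: (posnP k) => [k0|k_gt0].
  rewrite k0 addn0 in rky *.
  by apply: climb_one; rewrite -rky; exact: e.
rewrite -[ext_child e f]/(comp (child_arrow e) (f : hom (x : tree_cat) y)).
by apply: climb_rcons; [exact: IH|exact: e].
Qed.

(** A node of rank [n.+1] is a child of one of finitely many nodes, along one of finitely many
    morphisms. *)
Lemma tree_finite_rank n : finite_set [set x : tree_cat | tree_rank x = n].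
Proof.
elim: n => [|n IH].
  apply: (@sub_finite_set _ _ [set root]); last exact: finite_set1.
  move=> x; elim/node_ind: x => // x s e _ e0.
  by have := etrans (esym e) e0.
(* The default [x] makes [child'] total, so that it can be applied to all of [hom (tip x) q]. *)
pose child' (x : node) (s : star (tip x)) :=
  if eqnP is ReflectT e then @child x s (esym e) else x.
pose B := \bigcup_(x in [set x : tree_cat | tree_rank x = n])
  \bigcup_(q in [set q : C | rank q = n.+1])
    [set child' x (existT _ q f) | f in [set: hom (tip x) q]].
apply: (@sub_finite_set _ _ B).
  move=> x; elim/node_ind: x => [e0|x s e _ rkx].
    by have := etrans (esym z0) e0.
  have {}rkx : rank (tip x) = n by apply: succn_inj; rewrite -e.
  exists x => //; exists (projT1 s); first by rewrite /= e rkx.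
  exists (projT2 s) => //.
  case: s e => q f e; rewrite /child'; case: eqnP => [e'|]; last by rewrite e.
  by rewrite (Prop_irrelevance (esym e') e).
apply: bigcup_finite => // x _; apply: bigcup_finite => [|q _].
  exact: (finite_rank (updownP C)).
exact/finite_image/(finite_hom (updownP C)).
Qed.

Lemma tree_updown_axioms : updown_axioms tree_rank.
Proof.
split.
- exact: tree_finite_rank.
- exists root; split.
    apply/seteqP; split=> [x|_ -> //].
    elim/node_ind: x => // x s e _ e0.
    by have := etrans (esym e) e0.
  move=> x; elim/node_ind: x => [|x s e [f]]; constructor.
    exact: ext_refl.
  exact: ext_child.
- move=> x y; have [[f]|nf] := pselect (inhabited (ext x y)).
    by apply: (@sub_finite_set _ _ [set f]) => // g _; apply: ext_irr.
  by apply: (@sub_finite_set _ _ set0) => // g _; apply: nf.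
- exact: ext_rank.
- by move=> x f; exists f; split; apply: ext_irr.
- exact: tree_climb.
- by move=> *; apply: ext_irr.
- by move=> *; apply: ext_irr.
Qed.

Definition tree : updown := Updown tree_updown_axioms.

Lemma tree_univalent : univalent tree.
Proof. by move=> x f; apply: ext_irr. Qed.

Definition univalent_tree : univalent_updown := UnivalentUpdown tree_univalent.

(** * The projection and its lifts through coverings *)

Lemma tree_proj_step_lifting :
  @unique_step_lifting univalent_tree C tree_proj.
Proof.
move=> x t e.
exists (existT _ (child e) (ext_child e (ext_refl x))); split=> [|[y f] ft].
  by case: t e => q f e; rewrite /star_map /= comp_idr.
case: f ft => [ft|{}y s e' f ft].
  move/(congr1 (fun t => rank (projT1 t))): ft; rewrite e /= => /eqP.
  by rewrite eqn_leq ltnn andbF.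
(* The last step already accounts for the single unit of rank, so what precedes it is trivial. *)
have xy : x = y.
  apply: (ext_rank_eq f); apply: succn_inj.
  by rewrite -e' -[LHS]/((rank (tip x)).+1) -e -ft.
case: y / xy s e' f ft => s e' f.
rewrite (ext_irr f (ext_refl x)) /star_map /= comp_idr => st.
have {}st : s = t by rewrite -st; case: (s).
by case: t / st e => e; rewrite (Prop_irrelevance e e').
Qed.

Section Lift.
Variables (D : updown) (phi : functor D C).
Hypothesis phi_lift : unique_step_lifting phi.
Variable w : D.
Hypothesis phi_w : phi w = z.

(* The base point p is kept apart from phi q' so that the chain recursion can
   use it without transporting s along phi q' = p. *)
Lemma step_lift p q' (eq' : phi q' = p) (s : star p) :
  rank (projT1 s) = (rank p).+1 ->
  exists t : star q', mk_arrow (fhom phi (projT2 t)) = mk_arrow (projT2 s).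
Proof.
case: p / eq' s => s e; have [t [<- _]] := phi_lift e.
by exists t.
Qed.

(** The recursion carries the proof that the lifted end lies over the end of the chain, since
    lifting the next step starts from it. *)
Fixpoint chain_lift p (c : chain p) : {q : D | phi q = p} :=
  match c in chain p return {q : D | phi q = p} with
  | chain_nil => exist _ w phi_w
  | chain_rcons p c s e =>
    let t := cid (step_lift (svalP (chain_lift c)) e) in
    exist _ (projT1 (sval t)) (mk_arrow_tgt (svalP t))
  end.

Definition node_lift (x : node) : D := sval (chain_lift (projT2 x)).

Definition child_lift x s e : hom (node_lift x) (node_lift (@child x s e)) :=
  projT2 (sval (cid (step_lift (svalP (chain_lift (projT2 x))) e))).

Definition tree_lift : functor tree_cat D := free_functor child_lift.

Lemma tree_proj_lift : tree_proj = functor_comp phi tree_lift.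
Proof.
apply: tree_functor_eq => [|x s e]; first by rewrite /= phi_w.
rewrite /= !comp_idr.
exact/esym/(svalP (cid (step_lift (svalP (chain_lift (projT2 x))) e))).
Qed.

End Lift.

End Tree.

Theorem theorem4p3 (C : univalent_updown) :
  exists (Ct : univalent_updown) (pi : functor Ct C),
    universal_covering_map pi.
Proof.
have [z [z0 _]] := exists_root C.
have tree_cov : @covering_map (univalent_tree z0) C (tree_proj z).
  by apply/covering_mapP; split=> //; apply: tree_proj_step_lifting.
exists (univalent_tree z0), (tree_proj z); split=> // C' phi phi_cov.
have [phi_rank phi_lift] := (covering_mapP phi).1 phi_cov.
have [w [w0 _]] := exists_root C'.
(* Roots match because [phi] preserves rank and only one object has rank zero. *)
have phi_w : phi w = z by apply: rank_zero_unique; rewrite ?phi_rank.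
exists (tree_lift phi_lift phi_w); split; last exact: tree_proj_lift.
by apply: (covering_map_cancel phi_cov); rewrite -tree_proj_lift.
Qed.
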